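(* Let $X$ be a compact metric space and let $F \subset X \times X$ be a closed, transitive relation on $X$. (a) Assume that $A, B$ are disjoint, closed subsets of $X$ with $A$ + invariant for $F$ (i.e. $F(A)\subset A$) and $B$ + invariant for $F^{-1}$ (i.e. $F^{-1}(B) \subset B$). There exists a continuous function $L: X \to [0,1]$ with $B = L^{-1}(0)$, $A = L^{-1}(1)$ and such that if $(x,y) \in F$, then $L(y) \ge L(x)$ with equality only when $$x,y \in A, \quad \text{or} \quad x,y \in B, \quad \text{or} \quad (y,x) \in F.$$ In particular, $L$ is a Lyapunov function for $F$ with $|F| \subset |L| \subset |F| \cup A \cup B$. (b) There exists a continuous function $L: X \to [0,1]$ such that if $(x,y) \in F$, then $L(y) \ge L(x)$ with equality only when, in addition, $(y,x) \in F$. In particular, $L$ is a Lyapunov function for $F$ with $|L| = |F|$.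
   Context: A relation $F$ on $X$ is a subset of $X\times X$; it is closed if it is a closed subset. $F(x)=\{y : (x,y)\in F\}$, $F(A)=\bigcup_{x\in A}F(x)$, $F^{-1}=\{(y,x):(x,y)\in F\}$. $F$ is transitive if $(x,y),(y,z)\in F$ implies $(x,z)\in F$. The cyclic set is $|F|=\{x : (x,x)\in F\}$. A continuous $L:X\to\mathbb{R}$ is a Lyapunov function for $F$ if $(x,y)\in F$ implies $L(x)\le L(y)$. A point $x$ is a regular point for $L$ (with respect to $F$) if $\sup L|F^{-1}(x) < L(x) < \inf L|F(x)$ (with $\sup\emptyset=-\infty$, $\inf\emptyset=+\infty$); otherwise $x$ is a critical point. $|L|$ denotes the set of critical points. *)

(* Defs.v *)
From mathcomp Require Import all_boot all_order all_algebra.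
From mathcomp Require Import all_classical all_reals all_analysis.

Set Implicit Arguments.
Unset Strict Implicit.
Unset Printing Implicit Defensive.

Export numFieldNormedType.Exports.

Local Open Scope classical_set_scope.
Local Open Scope ring_scope.

(* A relation on X is a set of pairs; F(x) is [xsection F x] and the inverse
   relation is the library's [(F^-1)%relation]. *)

Definition rel_image (X : Type) (F : set (X * X)) (A : set X) : set X :=
  \bigcup_(x in A) xsection F x.

Definition plus_invariant (X : Type) (F : set (X * X)) (A : set X) : Prop :=
  rel_image F A `<=` A.

Definition transitive_rel (X : Type) (F : set (X * X)) : Prop :=
  forall x y z : X, F (x, y) -> F (y, z) -> F (x, z).

Definition cyclic_set (X : Type) (F : set (X * X)) : set X :=
  [set x | F (x, x)].

Definition lyapunov (R : realType) (X : topologicalType) (F : set (X * X))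
    (L : X -> R) : Prop :=
  continuous L /\ forall x y : X, F (x, y) -> L x <= L y.

(* The bounds are taken in the extended reals, where [ereal_sup set0 = -oo]
   and [ereal_inf set0 = +oo]. *)
Definition regular_point (R : realType) (X : Type) (F : set (X * X))
    (L : X -> R) (x : X) : Prop :=
  (ereal_sup [set (L y)%:E | y in xsection (F^-1)%relation x] < (L x)%:E)%E /\
  ((L x)%:E < ereal_inf [set (L y)%:E | y in xsection F x])%E.

Definition critical_set (R : realType) (X : Type) (F : set (X * X))
    (L : X -> R) : set X :=
  [set x | ~ regular_point F L x].

(* Main.v *)
Require Import Defs.
From HB Require Import structures.
From mathcomp Require Import all_boot all_order all_algebra.
From mathcomp Require Import all_classical all_reals all_analysis.
From mathcomp Require Import ring lra.

(** The relation [F] together with the diagonal is a closed preorder on a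
    compact space, and the theorem is a strict version of Nachbin's ordered
    form of Urysohn's lemma for it.

    Call a set invariant when [F] does not lead out of it. The smallest
    invariant set containing a closed set [C] is [C] together with its image,
    and it is closed because images of closed sets under a closed relation on
    a compact Hausdorff space are closed. Applying this hull on both sides of
    an ordinary normality argument inserts, between a closed invariant set and
    an open invariant set around it, an open invariant set inside a closed
    invariant one ([invariant_interpolation]). Iterating along the dyadic
    numbers gives a continuous function whose sublevel sets are invariant for
    the inverse relation, hence which is monotone along [F]
    ([monotone_urysohn]).

    Let [F(x, y)] with [~ F(y, x)], and suppose that [x] and [y] are neither
    both in [A] nor both in [B]. Then [x] is outside [A] and [y] outside [B]
    by invariance, and adding the forward hull of [y] to [A] and the backward
    hull of [x] to [B] keeps the two sets disjoint. So some monotone function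
    that is 0 on [B] and 1 on [A] satisfies [L x < L y] ([separate_disjoint]).
    For a single function this is an open condition on [(x, y)], and [X * X]
    has a countable base, so countably many functions take care of all such
    pairs. In the same way, countably many functions are enough to have one
    below 1 at each point outside [A], and one above 0 at each point outside
    [B]. A weighted
    average of all these functions, with positive weights of sum 1, is strict
    wherever one of them is ([complete_separator]).

    Strict growth along [F] at [x] gives regularity because the past and the
    future of [x] are compact, so that the extrema of [L] on them are attained
    ([strict_regular_point]). Part (b) is part (a) with [A] and [B] empty. *)

Import Order.TTheory GRing.Theory Num.Theory.

Set Implicit Arguments.
Unset Strict Implicit.
Unset Printing Implicit Defensive.

Local Open Scope classical_set_scope.
Local Open Scope ring_scope.

(** * Dyadically weighted averages of sequences in the unit interval *)

Section DyadicMean.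
Context {R : realType}.
Implicit Types u v : nat -> R.

(** The weights are [1 / 2 ^ n.+1], of sum 1. *)
Definition dyadic_term u : nat -> R := fun n => u n * geometric 2^-1 2^-1 n.

Definition dyadic_mean u : R := limn (series (dyadic_term u)).

Let unit_seq u := forall n, 0 <= u n <= 1.

Lemma dyadic_weight_gt0 n : 0 < geometric 2^-1 2^-1 n :> R.
Proof. by rewrite /= mulr_gt0 ?exprn_gt0 ?invr_gt0. Qed.

Lemma cvg_dyadic_weights :
  series (geometric 2^-1 2^-1 : nat -> R) n @[n --> \oo] --> (1 : R).
Proof.
have e : 2^-1 / (1 - 2^-1) = 1 :> R by field.
rewrite -[X in _ --> X]e; apply: cvg_geometric_series.
by rewrite ger0_norm ?invf_lt1 ?invr_ge0// ltr1n.
Qed.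

Lemma is_cvg_dyadic_term u : unit_seq u -> cvgn (series (dyadic_term u)).
Proof.
move=> u01; apply: (@series_le_cvg _ _ (geometric 2^-1 2^-1)).
- move=> n; have /andP[u0 _] := u01 n.
  by rewrite mulr_ge0// ltW// dyadic_weight_gt0.
- by move=> n; rewrite ltW// dyadic_weight_gt0.
- move=> n; have /andP[_ u1] := u01 n.
  by rewrite /dyadic_term ler_piMl// ltW// dyadic_weight_gt0.
- by apply/cvg_ex; exists 1; exact: cvg_dyadic_weights.
Qed.

Lemma dyadic_mean1 : dyadic_mean (fun=> 1) = 1.
Proof.
apply/cvg_lim; first exact: Rhausdorff.
rewrite (_ : dyadic_term _ = geometric 2^-1 2^-1).
  exact: cvg_dyadic_weights.
by apply/funext => n; rewrite /dyadic_term mul1r.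
Qed.

Lemma dyadic_mean0 : dyadic_mean (fun=> 0) = 0.
Proof.
apply/cvg_lim; first exact: Rhausdorff.
rewrite (_ : series _ = fun=> 0); first exact: cvg_cst.
apply/funext => n; rewrite /series/= big1// => i _.
by rewrite /dyadic_term mul0r.
Qed.

Lemma dyadic_meanB u v : unit_seq u -> unit_seq v ->
  dyadic_mean (fun n => u n - v n) = dyadic_mean u - dyadic_mean v.
Proof.
move=> u01 v01; rewrite /dyadic_mean -limB; [|exact: is_cvg_dyadic_term..].
congr (limn _); apply/funext => n.
rewrite -[RHS]/(series _ n - series _ n) /series/= -sumrB.
by apply: eq_bigr => i _; rewrite /dyadic_term mulrBl.
Qed.

Lemma ge_partial_dyadic_mean u n : unit_seq u ->
  series (dyadic_term u) n <= dyadic_mean u.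
Proof.
move=> u01; apply: nondecreasing_cvgn_le; last exact: is_cvg_dyadic_term.
apply: nondecreasing_series => k _ _; have /andP[u0 _] := u01 k.
by rewrite mulr_ge0// ltW// dyadic_weight_gt0.
Qed.

Lemma ler_dyadic_mean u v : unit_seq u -> unit_seq v ->
  (forall n, u n <= v n) -> dyadic_mean u <= dyadic_mean v.
Proof.
move=> u01 v01 uv; apply: lim_series_le; [exact: is_cvg_dyadic_term..|].
by move=> n; rewrite ler_wpM2r// ltW// dyadic_weight_gt0.
Qed.

Lemma ltr_dyadic_mean u v k : unit_seq u -> unit_seq v ->
  (forall n, u n <= v n) -> u k < v k -> dyadic_mean u < dyadic_mean v.
Proof.
move=> u01 v01 uv uvk; rewrite -subr_gt0 -dyadic_meanB//.
have d01 : unit_seq (fun n => v n - u n).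
  by move=> n; have := u01 n; have := v01 n; have := uv n; lra.
apply: lt_le_trans (ge_partial_dyadic_mean k.+1 d01).
rewrite /series/= big_nat_recr//= ltr_wpDl//.
  apply: sumr_ge0 => i _; rewrite mulr_ge0 ?subr_ge0//.
  by rewrite ltW// dyadic_weight_gt0.
by rewrite mulr_gt0 ?subr_gt0// dyadic_weight_gt0.
Qed.

Lemma dyadic_mean_itv u : unit_seq u -> 0 <= dyadic_mean u <= 1.
Proof.
move=> u01; rewrite -{1}dyadic_mean0 -[X in _ && (_ <= X)]dyadic_mean1.
by apply/andP; split; apply: ler_dyadic_mean => // n; rewrite ?lexx ?ler01//;
  have /andP[] := u01 n.
Qed.

(** Replacing [u] by [1 - u], whose mean is also bounded below by its partial
    sums, bounds the tail by that of the weights alone. The bound does not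
    depend on [u], so a mean of functions is a uniform limit of its partial
    sums. *)
Lemma dyadic_mean_tail u n : unit_seq u ->
  dyadic_mean u - series (dyadic_term u) n <=
  1 - series (geometric 2^-1 2^-1) n.
Proof.
move=> u01; have c01 : unit_seq (fun n => 1 - u n).
  by move=> k; have := u01 k; lra.
have := ge_partial_dyadic_mean n c01.
rewrite (@dyadic_meanB (fun=> 1))//; last by move=> k; rewrite ler01 lexx.
rewrite dyadic_mean1.
have -> : series (dyadic_term (fun n => 1 - u n)) n =
    series (geometric 2^-1 2^-1) n - series (dyadic_term u) n.
  rewrite /series/= -sumrB; apply: eq_bigr => i _.
  by rewrite /dyadic_term mulrBl mul1r.
lra.
Qed.

Lemma continuous_dyadic_mean {X : topologicalType} (K : nat -> X -> R) :
  (forall n, continuous (K n)) -> (forall n x, 0 <= K n x <= 1) ->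
  continuous (fun x => dyadic_mean (K ^~ x)).
Proof.
move=> cK K01 x; apply/cvgrPdist_le => e e0.
have e30 : 0 < e / 3 by rewrite divr_gt0.
have [n nlt] : exists n, `|1 - series (geometric 2^-1 2^-1) n| <= e / 3 :> R.
  have /cvgrPdist_le/(_ _ e30)[n _ Hn] := cvg_dyadic_weights.
  by exists n; apply: Hn => /=.
have cS : continuous (fun y => series (dyadic_term (K ^~ y)) n).
  rewrite /series/=; apply: continuous_big => [|i _].
    exact: add_continuous.
  by move=> y; apply: cvgMr_tmp; exact: cK.
have /cvgrPdist_le/(_ _ e30) := cS x; apply: filterS => y.
have K01x z : unit_seq (K ^~ z) by move=> k; exact: K01.
have := ge_partial_dyadic_mean n (K01x x).
have := ge_partial_dyadic_mean n (K01x y).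
have := dyadic_mean_tail n (K01x x).
have := dyadic_mean_tail n (K01x y).
move: nlt; rewrite !ler_norml.
lra.
Qed.

End DyadicMean.

(** * Countable subfamilies *)

(** A nonempty space can be pointed, and the empty one has the empty base. *)
Lemma compact_pseudometric_second_countable {R : realType}
    (X : pseudoMetricType R) : compact [set: X] -> @second_countable X.
Proof.
move=> cX; have [[x0 _]|X0] := pselect ([set: X] !=set0).
  pose P : pseudoPMetricType R := HB.pack X (isPointed.Build X x0).
  exact: (@compact_second_countable R P cX).
exists set0; first exact: countable0.
by split=> // x; exfalso; apply: X0; exists x.
Qed.

(** Lindelof's covering property: for each basic open set contained in some
    [O i], one such [i] is chosen; the base being countable, this takes
    countably many choices. *)
Lemma second_countable_lindelof {X : topologicalType} {I : Type} (P : set I)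
    (O : I -> set X) : @second_countable X -> P !=set0 ->
    (forall i, P i -> open (O i)) ->
  exists i_ : nat -> I, (forall n, P (i_ n)) /\
    forall x i, P i -> O i x -> exists n, O (i_ n) x.
Proof.
move=> [B /countable_injP[f finj] [_ basisB]] [i0 Pi0] oO.
have H n : exists i, P i /\ forall b, B b -> f b = n ->
    (exists2 j, P j & b `<=` O j) -> b `<=` O i.
  have [[b [Bb fb [j Pj bj]]]|nb] := pselect (exists b,
      [/\ B b, f b = n & exists2 j, P j & b `<=` O j]).
    exists j; split=> // c Bc fc _; suff -> : c = b by [].
    by apply: finj; rewrite ?inE// fb.
  exists i0; split=> // b Bb fb bj; exfalso; apply: nb; exists b; split=> //.
have [i_ Hi] := choice H.
exists i_; split=> [n|x i Pi Oix]; first by have [] := Hi n.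
have [b [Bb bx] bO] := basisB x _ (open_nbhs_nbhs (conj (oO i Pi) Oix)).
by exists (f b); apply: (Hi (f b)).2 Bb erefl _ _ bx; exists i.
Qed.

(** * The function of a dyadic scale of sets *)

Lemma dyadic_refine {T : Type} (S : nat -> nat -> T) :
    (forall n k, S n.+1 k.*2 = S n k) ->
  forall n m k, S (m + n)%N (k * 2 ^ m)%N = S n k.
Proof.
move=> refineS n; elim=> [|m IH] k; first by rewrite muln1.
by rewrite addSn expnSr mulnA muln2 refineS.
Qed.

(** At level [n] of the scale, [V n k] and [D n k] are an open set and a closed
    set around it attached to the dyadic number [k / 2 ^ n]; the closed set of
    an index lies in the open set of the next one. From the index
    [2 ^ n] on, the closed sets are the whole space; letting [k] run over all
    of [nat] saves carrying bounds on the indices. *)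
Section DyadicScale.
Context {R : realType} {X : topologicalType}.
Variables (V D : nat -> nat -> set X).
Hypothesis openV : forall n k, open (V n k).
Hypothesis closedD : forall n k, closed (D n k).
Hypothesis subVD : forall n k, V n k `<=` D n k.
Hypothesis subDV : forall n k, D n k `<=` V n k.+1.
Hypothesis refineV : forall n k, V n.+1 k.*2 = V n k.
Hypothesis refineD : forall n k, D n.+1 k.*2 = D n k.
Hypothesis topD : D 0%N 1%N = setT.

Definition scale_values (x : X) : set R :=
  [set r | exists n k, D n k x /\ r = k%:R / 2 ^+ n].

Definition scale_function (x : X) : R := inf (scale_values x).

Let pow2_gt0 n : 0 < 2 ^+ n :> R. Proof. by rewrite exprn_gt0. Qed.

Lemma scale_homo n : {homo D n : j k / (j <= k)%N >-> j `<=` k}.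
Proof.
move=> j k /subnK <-; elim: (k - j)%N => [|m IH]; first by rewrite add0n.
apply: subset_trans IH _; rewrite addSn.
exact: subset_trans (@subDV _ _) (@subVD _ _).
Qed.

Lemma scale_top n : D n (2 ^ n)%N = setT.
Proof. by rewrite -topD -(dyadic_refine refineD 0 n 1) addn0 mul1n. Qed.

Lemma scale_lt_subset n j k : (j < k)%N -> D n j `<=` V n k.
Proof.
case: k => // k jk; apply: subset_trans (@subDV _ _).
exact: scale_homo.
Qed.

Lemma scale_values_lbound x : lbound (scale_values x) 0.
Proof. by move=> _ [n [k [_ ->]]]; rewrite divr_ge0// exprn_ge0. Qed.

Lemma scale_values_neq0 x : scale_values x !=set0.
Proof. by exists (1%:R / 2 ^+ 0); exists 0%N, 1%N; rewrite topD. Qed.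

Lemma scale_function_le n k x : D n k x -> scale_function x <= k%:R / 2 ^+ n.
Proof.
move=> Dx; apply: ge_inf; last by exists n, k.
by exists 0; exact: scale_values_lbound.
Qed.

Lemma scale_function_ge n k x : ~ D n k x -> k%:R / 2 ^+ n <= scale_function x.
Proof.
move=> nDx; apply: lb_le_inf; first exact: scale_values_neq0.
move=> _ [m [j [Djx ->]]].
(* compare the two dyadic numbers at the common level [n + m] *)
rewrite ler_pdivrMr// mulrAC ler_pdivlMr// -!natrX -!natrM ler_nat.
rewrite ltnW// ltnNge.
apply/negP => jk; apply: nDx; rewrite -(dyadic_refine refineD n m) addnC.
by apply: (scale_homo jk); rewrite (dyadic_refine refineD).
Qed.

Lemma scale_function_itv x : 0 <= scale_function x <= 1.
Proof.
apply/andP; split.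
  by apply: lb_le_inf; [exact: scale_values_neq0|exact: scale_values_lbound].
by have := @scale_function_le 0 1 x; rewrite topD divr1; exact.
Qed.

Lemma scale_function_eq0 x : D 0%N 0%N x -> scale_function x = 0.
Proof.
move=> /scale_function_le; rewrite mul0r => f0.
by apply/le_anti; rewrite f0; have /andP[] := scale_function_itv x.
Qed.

Lemma scale_function_eq1 x : ~ V 0%N 1%N x -> scale_function x = 1.
Proof.
move=> nVx; apply/le_anti; have /andP[_ ->]/= := scale_function_itv x.
apply: lb_le_inf; first exact: scale_values_neq0.
move=> _ [n [k [Dx ->]]]; rewrite ler_pdivlMr// mul1r -natrX ler_nat leqNgt.
apply/negP => kn; apply: nVx.
rewrite -(dyadic_refine refineV 0 n 1) addn0 mul1n.
exact: scale_lt_subset kn _ Dx.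
Qed.

Lemma ler_scale_function x y :
  (forall n k, D n k y -> D n k x) -> scale_function x <= scale_function y.
Proof.
move=> Dyx; apply: lb_le_inf; first exact: scale_values_neq0.
by move=> _ [n [k [/Dyx Dx ->]]]; exact: scale_function_le.
Qed.

(** If [k] is the least index at level [n] with [D n k x], then the points of
    the neighbourhood [V n k.+1 `\` D n k.-1] of [x] have values between
    [(k - 1) / 2 ^ n] and [(k + 1) / 2 ^ n]. *)
Lemma continuous_scale_function : continuous scale_function.
Proof.
move=> x; apply/cvgrPdist_le => e e0.
have [n ne] : exists n, 2 / 2 ^+ n <= e.
  have half1 : `|2^-1| < 1 :> R.
    by rewrite ger0_norm ?invf_lt1 ?invr_ge0// ltr1n.
  have /cvgrPdist_le/(_ _ e0)[n _ Hn] := cvg_geometric 2 half1.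
  exists n; have /= := Hn n (leqnn n).
  by rewrite sub0r normrN exprVn ger0_norm// divr_ge0// ltW.
have exk : exists k, `[< D n k x >].
  by exists (2 ^ n)%N; apply/asboolP; rewrite scale_top.
have [k Dk kmin] := ex_minnP exk.
have lo y : (k > 0 -> ~ D n k.-1 y)%N ->
    (k%:R - 1) / 2 ^+ n <= scale_function y.
  move=> nD; have [k0|k0] := posnP k.
    have /andP[f0 _] := scale_function_itv y; apply: le_trans f0.
    by rewrite k0 sub0r mulNr oppr_le0 mul1r invr_ge0 ltW.
  by rewrite -{1}(prednK k0) -natr1 addrK; exact/scale_function_ge/nD.
have nDx : (k > 0 -> ~ D n k.-1 x)%N.
  by move=> k0 /asboolP/kmin; rewrite leqNgt prednK// leqnn.
have lox := lo x nDx.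
move/asboolP : Dk => Dx; have upx := scale_function_le Dx.
have nearV : \forall y \near x, V n k.+1 y.
  by apply: open_nbhs_nbhs; split=> //; exact: subDV.
have nearD : \forall y \near x, (k > 0 -> ~ D n k.-1 y)%N.
  have [k0|k0] := posnP k; first exact: nearW.
  apply: (@filterS _ _ _ (~` D n k.-1)) => [y Dy _//|].
  by apply: open_nbhs_nbhs; split; [exact: closed_openC|exact: nDx].
near=> y.
have loy : (k%:R - 1) / 2 ^+ n <= scale_function y.
  by apply: lo; near: y.
have upy : scale_function y <= (k%:R + 1) / 2 ^+ n.
  by rewrite natr1; apply/scale_function_le/subVD; near: y.
rewrite ler_norml; move: ne lox upx loy upy.
rewrite !mulrDl mulNr mul1r.
have := pow2_gt0 n; lra.
Unshelve. all: by end_near. Qed.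

End DyadicScale.

(** * Invariant sets and their hulls *)

Lemma plus_invariantP (X : Type) (F : set (X * X)) (A : set X) :
  plus_invariant F A <-> forall x y, F (x, y) -> A x -> A y.
Proof.
split=> [iA x y Fxy Ax|iA y [x Ax /xsectionP Fxy]]; last exact: iA Fxy Ax.
by apply: iA; exists x => //; apply/xsectionP.
Qed.

Lemma plus_invariantC (X : Type) (F : set (X * X)) (A : set X) :
  plus_invariant F A -> plus_invariant (F^-1)%relation (~` A).
Proof.
move=> /plus_invariantP iA; apply/plus_invariantP => x y /= Fyx nAx Ay.
exact/nAx/(iA y).
Qed.

Lemma plus_invariantU (X : Type) (F : set (X * X)) (A B : set X) :
  plus_invariant F A -> plus_invariant F B -> plus_invariant F (A `|` B).
Proof.
move=> /plus_invariantP iA /plus_invariantP iB; apply/plus_invariantP.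
by move=> x y Fxy [/(iA _ _ Fxy)|/(iB _ _ Fxy)]; [left|right].
Qed.

Lemma transitive_rel_inv (X : Type) (F : set (X * X)) :
  transitive_rel F -> transitive_rel (F^-1)%relation.
Proof. by move=> tF x y z /= Fyx Fzy; exact: tF Fzy Fyx. Qed.

Definition forward_hull (X : Type) (F : set (X * X)) (C : set X) : set X :=
  C `|` rel_image F C.

Lemma sub_forward_hull (X : Type) (F : set (X * X)) (C : set X) :
  C `<=` forward_hull F C.
Proof. exact: subsetUl. Qed.

Lemma forward_hull_invariant (X : Type) (F : set (X * X)) (C : set X) :
  transitive_rel F -> plus_invariant F (forward_hull F C).
Proof.
move=> tF; apply/plus_invariantP => x y Fxy [Cx|[z Cz /xsectionP Fzx]]; right.
- by exists x => //; apply/xsectionP.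
- by exists z => //; apply/xsectionP; exact: tF Fzx Fxy.
Qed.

Lemma forward_hull_min (X : Type) (F : set (X * X)) (C D : set X) :
  C `<=` D -> plus_invariant F D -> forward_hull F C `<=` D.
Proof.
move=> CD /plus_invariantP iD x [/CD//|[y Cy /xsectionP Fyx]].
by apply: iD Fyx _; exact: CD.
Qed.

Lemma closed_rel_inv (X : topologicalType) (F : set (X * X)) :
  closed F -> closed (F^-1)%relation.
Proof.
move=> cF; apply: (@closed_comp _ _ unstable.swap) => // xy _.
exact: swap_continuous.
Qed.

Lemma closed_section (X : topologicalType) (F : set (X * X)) (x : X) :
  closed F -> closed (xsection F x).
Proof.
move=> cF; rewrite xsectionE; apply: closed_comp => // y _.
by apply: cvg_pair; [exact: cvg_cst|exact: cvg_id].
Qed.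

Section CompactRelation.
Context {X : topologicalType}.
Variable F : set (X * X).
Hypotheses (cptX : compact [set: X]) (hausX : hausdorff_space X).
Hypothesis closedF : closed F.

(** A projection of a compact part of the graph. *)
Lemma closed_rel_image (C : set X) : closed C -> closed (rel_image F C).
Proof.
move=> cC.
have -> : rel_image F C = snd @` (F `&` fst @^-1` C).
  apply/seteqP; split=> [y [x Cx /xsectionP Fxy]|_ [[x y] [Fxy Cx] <-]].
    by exists (x, y).
  by exists x => //; apply/xsectionP.
apply: compact_closed => //; apply: continuous_compact.
  by apply: continuous_subspaceT => xy; exact: cvg_snd.
apply: (@subclosed_compact _ _ (setT `*` setT)); last by move=> [].
  apply: closedI => //; apply: closed_comp => // xy _; exact: cvg_fst.
exact: compact_setX.
Qed.

Lemma closed_forward_hull (C : set X) : closed C -> closed (forward_hull F C).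
Proof. by move=> cC; apply: closedU => //; exact: closed_rel_image. Qed.

End CompactRelation.

(** * Urysohn's lemma for invariant sets *)

Section InvariantUrysohn.
Context {X : topologicalType}.
Variable F : set (X * X).
Hypotheses (cptX : compact [set: X]) (hausX : hausdorff_space X).
Hypotheses (closedF : closed F) (transF : transitive_rel F).

(** The open set and the closed set attached to one index of a dyadic scale. *)
Definition invariant_layer (p : set X * set X) : Prop :=
  [/\ open p.1, closed p.2, p.1 `<=` p.2,
      plus_invariant F p.1 & plus_invariant F p.2].

(** Normality gives a neighbourhood [N] of [C] with closure inside [U]. Its
    closure becomes invariant by enlarging it to its forward hull, which stays
    in [U]; its interior becomes invariant by removing the backward hull of its
    complement, which does not meet [C]. *)
Lemma invariant_interpolation (C U : set X) :
    closed C -> open U -> plus_invariant F C -> plus_invariant F U ->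
    C `<=` U ->
  exists p, [/\ invariant_layer p, C `<=` p.1 & p.2 `<=` U].
Proof.
move=> cC oU iC iU CU.
have [N CN NU] : filter_from (set_nbhs C) closure U.
  apply: (compact_normal hausX cptX cC) => x Cx.
  by apply: open_nbhs_nbhs; split=> //; exact: CU.
have closed_back (E : set X) :
    closed E -> closed (forward_hull (F^-1)%relation E).
  by apply: closed_forward_hull => //; exact: closed_rel_inv.
exists (~` forward_hull (F^-1)%relation (~` N°), forward_hull F (closure N)).
split=> [|x Cx|]; last 1 first.
- exact: forward_hull_min.
- split=> /=.
  + by apply/closed_openC/closed_back/open_closedC/open_interior.
  + by apply: closed_forward_hull => //; exact: closed_closure.
  + apply: (@subset_trans _ N°).
      rewrite -[X in _ `<=` X]setCK; apply: subsetC; exact: sub_forward_hull.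
    apply: subset_trans (@sub_forward_hull _ F _).
    exact: subset_trans (@interior_subset _ _) (@subset_closure _ _).
  + apply: (@plus_invariantC _ (F^-1)%relation).
    by apply: forward_hull_invariant; exact: transitive_rel_inv.
  + exact: forward_hull_invariant.
- have := @forward_hull_min _ (F^-1)%relation (~` N°) (~` C).
  move=> /(_ _ (plus_invariantC iC)) H /H; apply => //.
  by apply: subsetC => z /CN.
Qed.

(** Level [n.+1] keeps the layers of level [n] at the even indices and
    interpolates between neighbours at the odd ones. *)
Lemma invariant_scale (C U : set X) :
    closed C -> open U -> plus_invariant F C -> plus_invariant F U ->
    C `<=` U ->
  exists s : nat -> nat -> set X * set X,
    [/\ forall n k, invariant_layer (s n k),
        forall n k, (s n k).2 `<=` (s n k.+1).1,
        forall n k, s n.+1 k.*2 = s n k,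
        (s 0%N 0%N).2 = C & s 0%N 1%N = (U, setT)].
Proof.
move=> cC oU iC iU CU.
have midpoint (pq : (set X * set X) * (set X * set X)) : exists r,
    invariant_layer pq.1 -> invariant_layer pq.2 -> pq.1.2 `<=` pq.2.1 ->
    [/\ invariant_layer r, pq.1.2 `<=` r.1 & r.2 `<=` pq.2.1].
  case: pq => p q /=.
  have [[lp lq pq]|H] := pselect
      [/\ invariant_layer p, invariant_layer q & p.2 `<=` q.1].
    have [[_ cp _ _ ip] [oq _ _ iq _]] := (lp, lq).
    by have [r Hr] := invariant_interpolation cp oq ip iq pq; exists r.
  (* an arbitrary value where the premises fail *)
  by exists p => lp lq pq; exfalso; exact: H.
have [I HI] := choice midpoint.
pose s0 k :=
  if k is k'.+1 then (if k' is 0 then U else setT, setT) else (set0, C).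
pose s := fix s n k := if n is n'.+1 then
  (if odd k then I (s n' k./2, s n' k./2.+1) else s n' k./2) else s0 k.
have sP n : (forall k, invariant_layer (s n k)) /\
    (forall k, (s n k).2 `<=` (s n k.+1).1).
  elim: n => [|n [IHl IHb]].
    split=> -[|[|k]] //=; split=> //=; try exact: open0; try exact: openT;
      try exact: closedT; by apply/plus_invariantP.
  have mid k := HI (s n k, s n k.+1) (IHl k) (IHl k.+1) (IHb k).
  split=> k /=; first by case: ifP => // _; have [] := mid k./2.
  rewrite uphalf_half; case: (odd k) => /=; by have [] := mid k./2.
exists s; split=> // n; [exact: (sP n).1|exact: (sP n).2|move=> k /=].
by rewrite odd_double doubleK.
Qed.

End InvariantUrysohn.

(** * Monotone functions separating invariant sets *)

Section MonotoneSeparation.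
Context {R : realType} {X : topologicalType}.
Implicit Types (F : set (X * X)) (A B : set X) (L : X -> R).

Definition monotone_separator F A B L : Prop :=
  [/\ continuous L, forall x, 0 <= L x <= 1,
      forall x y, F (x, y) -> L x <= L y,
      forall x, B x -> L x = 0 & forall x, A x -> L x = 1].

Lemma monotone_separatorS F A B A' B' L : A `<=` A' -> B `<=` B' ->
  monotone_separator F A' B' L -> monotone_separator F A B L.
Proof.
by move=> AA' BB' [cL L01 mL L0 L1]; split=> // x; [move/BB'/L0|move/AA'/L1].
Qed.

Lemma monotone_separator_mean F A B (K : nat -> X -> R) :
  (forall n, monotone_separator F A B (K n)) ->
  monotone_separator F A B (fun x => dyadic_mean (K ^~ x)).
Proof.
move=> sK; have K01 n x : 0 <= K n x <= 1 by have [] := sK n.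
split.
- by apply: continuous_dyadic_mean => // n; have [] := sK n.
- by move=> x; apply: dyadic_mean_itv.
- move=> x y Fxy; apply: ler_dyadic_mean => // n.
  by have [_ _ + _ _] := sK n; exact.
- move=> x Bx; rewrite -[RHS]dyadic_mean0; congr dyadic_mean.
  by apply/funext => n; have [_ _ _ + _] := sK n; exact.
- move=> x Ax; rewrite -[RHS]dyadic_mean1; congr dyadic_mean.
  by apply/funext => n; have [_ _ _ _ +] := sK n; exact.
Qed.

(** The scale runs from [B] to the complement of [A] through sets invariant
    under the inverse of [F]: a step of [F] can then only leave sets of the
    scale, so the function of the scale cannot decrease along it. *)
Lemma monotone_urysohn F A B : compact [set: X] -> hausdorff_space X ->
    closed F -> transitive_rel F -> closed A -> closed B ->
    plus_invariant F A -> plus_invariant (F^-1)%relation B -> A `&` B = set0 ->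
  exists L, monotone_separator F A B L.
Proof.
move=> cptX hausX cF tF cA cB iA iB AB0.
have BnA : B `<=` ~` A by move=> x Bx Ax; have : (A `&` B) x by []; rewrite AB0.
have [s [layer below refine s00 s01]] := invariant_scale cptX hausX
  (closed_rel_inv cF) (transitive_rel_inv tF) cB (closed_openC cA) iB
  (plus_invariantC iA) BnA.
pose V n k := (s n k).1; pose D n k := (s n k).2.
have oV n k : open (V n k) by have [] := layer n k.
have cD n k : closed (D n k) by have [] := layer n k.
have VD n k : V n k `<=` D n k by have [] := layer n k.
have refV n k : V n.+1 k.*2 = V n k by rewrite /V refine.
have refD n k : D n.+1 k.*2 = D n k by rewrite /D refine.
have topD : D 0%N 1%N = setT by rewrite /D s01.
exists (scale_function (R := R) D); split.
- exact: continuous_scale_function oV cD VD below refD topD.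
- exact: scale_function_itv topD.
- move=> x y Fxy; apply: ler_scale_function => // n k.
  by have [_ _ _ _ /plus_invariantP] := layer n k; exact.
- by move=> x Bx; apply: scale_function_eq0 => //; rewrite /D s00.
- move=> x Ax; apply: (@scale_function_eq1 _ _ V) => //.
  by rewrite /V s01; exact.
Qed.

End MonotoneSeparation.

(** * A strict separator *)

Section CompleteSeparator.
Context {R : realType} {X : metricType R}.
Variable F : set (X * X).
Hypotheses (cptX : compact [set: X]) (closedF : closed F).
Hypothesis transF : transitive_rel F.
Variables A B : set X.
Hypotheses (closedA : closed A) (closedB : closed B) (AB0 : A `&` B = set0).
Hypothesis invA : plus_invariant F A.
Hypothesis invB : plus_invariant (F^-1)%relation B.

Let closed1 (x : X) : closed [set x].
Proof. exact/accessible_closed_set1/hausdorff_accessible/metric_hausdorff. Qed.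

(** The hypotheses on [C] and [D] say exactly that [A] enlarged by the forward
    hull of [C] and [B] enlarged by the backward hull of [D] are disjoint. *)
Lemma separate_disjoint (C D : set X) :
    closed C -> closed D -> C `<=` ~` B -> D `<=` ~` A ->
    (forall x y, C x -> D y -> x <> y /\ ~ F (x, y)) ->
  exists L : X -> R, [/\ monotone_separator F A B L,
    forall x, C x -> L x = 1 & forall x, D x -> L x = 0].
Proof.
move=> cC cD CnB DnA CD.
pose A' := A `|` forward_hull F C.
pose B' := B `|` forward_hull (F^-1)%relation D.
have hausX := @metric_hausdorff R X.
have cFV := closed_rel_inv closedF.
have hCnB : forward_hull F C `<=` ~` B.
  by apply: forward_hull_min => //; exact: (plus_invariantC invB).
have hDnA : forward_hull (F^-1)%relation D `<=` ~` A.
  by apply: forward_hull_min => //; exact: plus_invariantC.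
have hCD z : forward_hull F C z -> ~ forward_hull (F^-1)%relation D z.
  move=> [Cz|[x Cx /xsectionP Fxz]] [Dz|[y Dy /xsectionP/= Fzy]].
  - by have [] := CD z z Cz Dz.
  - by have [] := CD z y Cz Dy.
  - by have [] := CD x z Cx Dz.
  - by have [_] := CD x y Cx Dy; apply; exact: transF Fxz Fzy.
have [] := @monotone_urysohn R X F A' B' cptX hausX closedF transF.
- by apply: closedU => //; exact: closed_forward_hull.
- by apply: closedU => //; apply: closed_forward_hull.
- exact: plus_invariantU invA (forward_hull_invariant transF).
- apply: plus_invariantU invB _.
  by apply: forward_hull_invariant; exact: transitive_rel_inv.
- apply/disjoints_subset => z [Az|hz] [Bz|hz'].
  + by have : (A `&` B) z by []; rewrite AB0.
  + exact: hDnA hz' Az.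
  + exact: hCnB hz Bz.
  + exact: hCD hz hz'.
move=> L sL; exists L; split.
- by apply: monotone_separatorS sL; exact: subsetUl.
- by have [_ _ _ _ L1] := sL => x Cx; apply: L1; right; exact: sub_forward_hull.
- by have [_ _ _ L0 _] := sL => x Dx; apply: L0; right; exact: sub_forward_hull.
Qed.

(** The three strict inequalities are open conditions, on [X] for the first two
    and on [X * X] for the third, and [separate_disjoint] meets each of them
    at every point concerned; a countable choice of functions for each one is
    then averaged. *)
Lemma complete_separator : exists L : X -> R,
  [/\ monotone_separator F A B L,
      forall x, ~ A x -> L x < 1,
      forall x, ~ B x -> 0 < L x &
      forall x y, F (x, y) -> ~ A x -> ~ B y -> ~ F (y, x) -> L x < L y].
Proof.
have cXX : compact [set: X * X] by rewrite -setXTT; exact: compact_setX.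
have sc := compact_pseudometric_second_countable cptX.
have scX := compact_pseudometric_second_countable cXX.
have P0 : [set L : X -> R | monotone_separator F A B L] !=set0.
  have [|||||L [sL _ _]] := @separate_disjoint set0 set0;
    try exact: closed0; rewrite //.
  by exists L.
have o1 (L : X -> R) : monotone_separator F A B L -> open [set x | L x < 1].
  by move=> [cL _ _ _ _]; apply: (@open_comp _ _ L [set r | r < 1]).
have o0 (L : X -> R) : monotone_separator F A B L -> open [set x | 0 < L x].
  by move=> [cL _ _ _ _]; apply: (@open_comp _ _ L [set r | 0 < r]).
have oF (L : X -> R) : monotone_separator F A B L ->
    open [set xy : X * X | L xy.1 < L xy.2].
  move=> [cL _ _ _ _].
  rewrite (_ : [set _ | _] =
      (fun xy : X * X => L xy.2 - L xy.1) @^-1` [set r | 0 < r]); last first.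
    by apply/seteqP; split=> xy /=; rewrite subr_gt0.
  apply: open_comp => // xy _.
  apply: cvgB; apply: continuous_comp; try exact: cL; first exact: cvg_snd.
  exact: cvg_fst.
have [a [sa Ha]] := second_countable_lindelof sc P0 o1.
have [b [sb Hb]] := second_countable_lindelof sc P0 o0.
have [c [sc' Hc]] := second_countable_lindelof scX P0 oF.
(* The three sequences are interleaved, so that one average serves all three
   conditions. *)
pose K n := nth a [:: a; b; c] (n %% 3)%N (n %/ 3)%N.
have KE i n : (i < 3)%N -> K (n * 3 + i)%N = nth a [:: a; b; c] i n.
  by move=> i3; rewrite /K modnMDl divnMDl// modn_small// divn_small// addn0.
have sK n : monotone_separator F A B (K n).
  rewrite /K; have := ltn_pmod n (isT : 0 < 3)%N.
  case: (n %% 3)%N => [|[|[|m]]] //= _.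
  - exact: sa.
  - exact: sb.
  - exact: sc'.
have K01 x n : 0 <= K n x <= 1 by have [] := sK n.
exists (fun x => dyadic_mean (K ^~ x)); split.
- exact: monotone_separator_mean.
- move=> x nAx.
  have [|||||L [sL _ L0]] := @separate_disjoint set0 [set x];
    try exact: closed0; rewrite //.
    by move=> _ ->.
  have [|n /= Kn] := Ha x L sL; first by rewrite /= L0.
  rewrite -[X in _ < X]dyadic_mean1.
  apply: (@ltr_dyadic_mean _ _ _ (n * 3 + 0)%N) => //; last by rewrite KE.
  + by move=> k; rewrite ler01 lexx.
  + by move=> k; have /andP[] := K01 x k.
- move=> x nBx.
  have [|||||L [sL L1 _]] := @separate_disjoint [set x] set0;
    try exact: closed0; rewrite //.
    by move=> _ ->.
  have [|n /= Kn] := Hb x L sL; first by rewrite /= L1.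
  rewrite -[X in X < _]dyadic_mean0.
  apply: (@ltr_dyadic_mean _ _ _ (n * 3 + 1)%N) => //; last by rewrite KE.
  + by move=> k; rewrite ler01 lexx.
  + by move=> k; have /andP[] := K01 x k.
- move=> x y Fxy nAx nBy nFyx.
  have [|||||L [sL L1 L0]] := @separate_disjoint [set y] [set x]; rewrite //.
  + by move=> _ ->.
  + by move=> _ ->.
  + by move=> _ _ -> ->; split=> // yx; apply: nFyx; rewrite yx in Fxy *.
  have [|n /= Kn] := Hc (x, y) L sL.
    by rewrite /= (L1 y erefl) (L0 x erefl).
  apply: (@ltr_dyadic_mean _ _ _ (n * 3 + 2)%N) => //; last by rewrite KE.
  by move=> k; have [_ _ + _ _] := sK k; exact.
Qed.

End CompleteSeparator.

(** * Regular and critical points *)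

Lemma cyclic_set_critical (R : realType) (X : Type) (F : set (X * X))
    (L : X -> R) : cyclic_set F `<=` critical_set F L.
Proof.
move=> x Fxx [_]; rewrite ltNge => /negP; apply; apply: ereal_inf_lbound.
by exists x => //; apply/xsectionP.
Qed.

(** The sections of [F] are compact, so that on the nonempty ones the extrema
    of [L] are attained and the pointwise strict inequalities pass to them. *)
Lemma strict_regular_point (R : realType) (X : topologicalType)
    (F : set (X * X)) (L : X -> R) (x : X) :
    compact [set: X] -> closed F -> continuous L ->
    (forall y, F (y, x) -> L y < L x) -> (forall y, F (x, y) -> L x < L y) ->
  regular_point F L x.
Proof.
move=> cptX cF cL Lpast Lfuture.
have cpt_section (G : set (X * X)) : closed G -> compact (xsection G x).
  by move=> cG; apply: subclosed_compact cptX _ => //; exact: closed_section.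
split.
- have [|/set0P ne] := eqVneq (xsection (F^-1)%relation x) set0.
    by move=> ->; rewrite image_set0 ereal_sup0 ltNyr.
  have [c /set_mem/xsectionP Fc cmax] := compact_EVT_max ne
    (cpt_section _ (closed_rel_inv cF)) (continuous_subspaceT cL).
  apply: (@le_lt_trans _ _ (L c)%:E); last by rewrite lte_fin; exact: Lpast.
  by apply: ge_ereal_sup => _ [y Fy <-]; rewrite lee_fin cmax// inE.
- have [|/set0P ne] := eqVneq (xsection F x) set0.
    by move=> ->; rewrite image_set0 ereal_inf0 ltry.
  have [c /set_mem/xsectionP Fc cmin] := compact_EVT_min ne
    (cpt_section _ cF) (continuous_subspaceT cL).
  apply: (@lt_le_trans _ _ (L c)%:E); first by rewrite lte_fin; exact: Lfuture.
  by apply: le_ereal_inf_tmp => _ [y Fy <-]; rewrite lee_fin cmin// inE.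
Qed.

(** * Existence of Lyapunov functions *)

Theorem theorem2p11 (R : realType) (X : metricType R) (F : set (X * X)) :
  compact [set: X] -> closed F -> transitive_rel F ->
  (forall A B : set X,
     A `&` B = set0 -> closed A -> closed B ->
     plus_invariant F A -> plus_invariant (F^-1)%relation B ->
     exists L : X -> R,
       [/\ continuous L,
           (forall x, 0 <= L x <= 1),
           B = L @^-1` [set 0] /\ A = L @^-1` [set 1],
           (forall x y, F (x, y) ->
              L x <= L y /\
              (L y = L x -> [\/ A x /\ A y, B x /\ B y | F (y, x)])) &
           [/\ lyapunov F L,
               cyclic_set F `<=` critical_set F L &
               critical_set F L `<=` cyclic_set F `|` A `|` B]]) /\
  (exists L : X -> R,
     [/\ continuous L,
         (forall x, 0 <= L x <= 1),
         (forall x y, F (x, y) ->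
            L x <= L y /\ (L y = L x -> F (y, x))) &
         lyapunov F L /\ critical_set F L = cyclic_set F]).
Proof.
move=> cptX cF tF.
set statement_a := (X in X /\ _); have partA : statement_a.
  move=> A B AB0 cA cB iA iB.
  have [L [[cL L01 mL L0 L1] ltL1 gtL0 ltL]] :=
    complete_separator cptX cF tF cA cB AB0 iA iB.
  have eqL x y : F (x, y) -> L y = L x ->
      [\/ A x /\ A y, B x /\ B y | F (y, x)].
    move=> Fxy Lyx.
    have [Fyx|nFyx] := pselect (F (y, x)); first by constructor 3.
    have [Ax|nAx] := pselect (A x).
      by constructor 1; split=> //; move/plus_invariantP : iA; apply; eauto.
    have [By|nBy] := pselect (B y).
      by constructor 2; split=> //; move/plus_invariantP : iB; apply; eauto.
    by have := ltL x y Fxy nAx nBy nFyx; rewrite Lyx ltxx.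
  have ltF x y : F (x, y) -> ~ (A x /\ A y) -> ~ (B x /\ B y) -> ~ F (y, x) ->
      L x < L y.
    move=> Fxy nA nB nF; rewrite lt_neqAle mL// andbT; apply/eqP => /esym.
    by case/(eqL _ _ Fxy).
  exists L; split=> //.
  - split; apply/seteqP; split=> x.
    + exact: L0.
    + by move=> /= Lx0; apply: contrapT => /gtL0; rewrite Lx0 ltxx.
    + exact: L1.
    + by move=> /= Lx1; apply: contrapT => /ltL1; rewrite Lx1 ltxx.
  - by move=> x y Fxy; split; [exact: mL|exact: eqL].
  - split=> //; first exact: cyclic_set_critical.
    move=> x crit; apply: contrapT => nx; apply: crit.
    have [nFx nAx nBx] : [/\ ~ F (x, x), ~ A x & ~ B x].
      by split=> ?; apply: nx; [left; left|left; right|right].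
    apply: strict_regular_point => // y Fxy; apply: ltF => //.
    + by case.
    + by case.
    + by move=> Fyx; apply: nFx; exact: tF Fyx Fxy.
    + by case.
    + by case.
    + by move=> Fyx; apply: nFx; exact: tF Fxy Fyx.
split=> //.
have [|||||L [cL L01 _ HL [lyapL cycL critL]]] := partA set0 set0.
- by rewrite setI0.
- exact: closed0.
- exact: closed0.
- by apply/plus_invariantP.
- by apply/plus_invariantP.
exists L; split=> //.
- by move=> x y /HL[Lxy Leq]; split=> // /Leq[[]|[]|].
- by split=> //; apply/seteqP; split=> // x /critL; rewrite !setU0.
Qed.
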